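(* Let $a$ be an element of a unital $C^*$-algebra $\mathfrak{A}$ with unit $1$ such that $a$ and $1-a$ are invertible, and let $\mathscr{E},\mathscr{F},\mathscr{G}$ be inner product $\mathfrak{A}$-modules. Suppose that there exist additive mappings $\varphi,\psi:\mathscr{F}\to\mathscr{E}$ such that $$\langle\varphi(z),\psi(w)\rangle=0\quad\text{and}\quad a\langle\varphi(z),\varphi(w)\rangle a^*=(1-a)\langle\psi(z),\psi(w)\rangle(1-a)^*\qquad\text{for all } z,w\in\mathscr{F}.$$ Let $\mathscr{K}:=\varphi(\mathscr{F})+\psi(\mathscr{F})$. If $f:\mathscr{E}\to\mathscr{G}$ is an orthogonally $a$-Jensen mapping, then there exist unique mappings $A:\mathscr{E}\to\mathscr{G}$ and $B:\mathscr{E}\times\mathscr{E}\to\mathscr{G}$ such that $A$ is $a$-additive on $\mathscr{K}$, $B$ is symmetric $a$-biadditive orthogonality preserving on $\mathscr{K}\times\mathscr{K}$, and $$f(x)=A(x)+B(x,x)+f(0)\qquad(x\in\mathscr{K}).$$ Moreover, $$B(x,y)=\tfrac18\big(f(x+y)+f(-x-y)-f(x-y)-f(-x+y)\big)\quad\text{and}\quad A(x)=\tfrac12\big(f(x)-f(-x)\big)$$ for every $x,y\in\mathscr{E}$.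
   Context: An inner product $\mathfrak{A}$-module is a (right) $\mathfrak{A}$-module $\mathscr{E}$ equipped with an $\mathfrak{A}$-valued inner product $\langle\cdot,\cdot\rangle$ which is $\mathbb{C}$-linear and $\mathfrak{A}$-linear in the second variable and satisfies $\langle x,y\rangle^*=\langle y,x\rangle$ and $\langle x,x\rangle\ge 0$ with equality if and only if $x=0$. Completeness is not assumed. The action of $c\in\mathfrak{A}$ on a module element $x$ is written $cx$. A mapping $f:\mathscr{E}\to\mathscr{G}$ is orthogonally $a$-Jensen if for all $x,y\in\mathscr{E}$, $\langle x,y\rangle=0$ implies $f(ax+(1-a)y)=af(x)+(1-a)f(y)$. An additive mapping $A$ is $a$-additive if $A(ax)=aA(x)$ for all $x$. A biadditive mapping $B$ (additive in each variable) is $a$-biadditive if $B(ax,ax)=aB(x,x)$ and $B((1-a)x,(1-a)x)=(1-a)B(x,x)$ for all $x$. It is symmetric if $B(x,y)=B(y,x)$ for all $x,y$, and orthogonality preserving if $\langle x,y\rangle=0$ implies $B(x,y)=0$. ''On $\mathscr{K}$'' or ''on $\mathscr{K}\times\mathscr{K}$'' means that these conditions hold for all $x,y\in\mathscr{K}$.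
   Formalization: Uniqueness of A and B is stated only on K and K×K: the conditions do not constrain the mappings off K, so uniqueness on all of E fails (e.g. for F=0, E≠0, G≠0). The explicit formulas on all of E are asserted for the constructed pair. *)

(* Defs.v *)
From HB Require Import structures.
From mathcomp Require Import all_boot all_order all_algebra.
From mathcomp Require Import all_classical all_reals all_analysis.
From mathcomp Require Export complex.

Set Implicit Arguments.
Unset Strict Implicit.
Unset Printing Implicit Defensive.

Import Order.TTheory GRing.Theory Num.Theory.
Import numFieldNormedType.Exports.

Local Open Scope classical_set_scope.
Local Open Scope ring_scope.

(* The norm is part of the mixin because the ring structures of MathComp cannot
   be joined with its normed modules, whose normed rings are all integral
   domains.  [UnitAlgebra] excludes the zero algebra; on it, [GRing.unit] is the
   set of all elements with a two-sided inverse. *)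
HB.mixin Record isCStarAlgebra (R : realType) A of GRing.UnitAlgebra R[i] A := {
  cnorm : A -> R ;
  star : A -> A ;
  cnorm0_eq0 : forall x, cnorm x = 0 -> x = 0 ;
  cnormD : forall x y, cnorm (x + y) <= cnorm x + cnorm y ;
  cnormZ : forall (k : R[i]) x,
    cnorm (k *: x) = ComplexField.Normc.normc k * cnorm x ;
  cnormM : forall x y, cnorm (x * y) <= cnorm x * cnorm y ;
  cnorm_complete : forall u : nat -> A,
    (forall e : R, 0 < e -> exists N, forall m n, (N <= m)%N -> (N <= n)%N ->
       cnorm (u m - u n) < e) ->
    exists l, cnorm (u n - l) @[n --> \oo] --> (0 : R) ;
  starK : forall x, star (star x) = x ;
  starD : forall x y, star (x + y) = star x + star y ;
  starZ : forall (k : R[i]) x, star (k *: x) = Num.conj k *: star x ;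
  starM : forall x y, star (x * y) = star y * star x ;
  cstar_identity : forall x, cnorm (star x * x) = cnorm x ^+ 2 }.

#[short(type="cstarAlgType")]
HB.structure Definition CStarAlgebra (R : realType) :=
  {A of GRing.UnitAlgebra R[i] A & isCStarAlgebra R A}.

Definition spectrum (R : realType) (A : cstarAlgType R) (p : A) : set R[i] :=
  [set k | k%:A - p \isn't a GRing.unit].

(* On [R[i]], [0 <= k] says that [k] is real and nonnegative. *)
Definition cstar_pos (R : realType) (A : cstarAlgType R) (p : A) : Prop :=
  star p = p /\ spectrum p `<=` [set k | 0 <= k].

(* A right [A]-module is a left module over the converse ring [A^c]: for
   [x : E] and [c : A], [c *: x] is [x] acted upon by [c] on the right, so
   [d *: (c *: x) = (c * d) *: x], the product being that of [A]. *)
HB.mixin Record isInnerProductModule (R : realType) (A : cstarAlgType R) E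
    of GRing.Lmodule A^c E := {
  inner : E -> E -> A ;
  innerDr : forall x y z, inner x (y + z) = inner x y + inner x z ;
  innerZr : forall x (c : A) y, inner x ((c : A^c) *: y) = inner x y * c ;
  inner_star : forall x y, star (inner x y) = inner y x ;
  inner_ge0 : forall x, cstar_pos (inner x x) ;
  inner_eq0 : forall x, inner x x = 0 <-> x = 0 }.

#[short(type="innerModType")]
HB.structure Definition InnerProductModule
    (R : realType) (A : cstarAlgType R) :=
  {E of GRing.Lmodule A^c E & isInnerProductModule R A E}.

(* [c <*: x] is the action written [c x] informally. *)
Definition mod_act (R : realType) (A : cstarAlgType R) (E : lmodType A^c)
  (c : A) (x : E) : E := (c : A^c) *: x.
Notation "c <*: x" := (mod_act c x)
  (at level 40, left associativity) : ring_scope.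

(* As [A] is unital, the complex scalars act on a module through [A]. *)
Definition complex_scale (R : realType) (A : cstarAlgType R) (E : lmodType A^c)
  (k : R[i]) (x : E) : E := (k%:A : A) <*: x.

Lemma inner_complex_scaler (R : realType) (A : cstarAlgType R)
    (E : innerModType A)
    (x y : E) (k : R[i]) :
  inner x (complex_scale k y) = k *: inner x y :> A.
Proof. by rewrite /complex_scale /mod_act innerZr -scalerAr mulr1. Qed.

Section Mappings.
Variables (R : realType) (A : cstarAlgType R) (a : A).

Definition orth_jensen (E G : innerModType A) (f : E -> G) : Prop :=
  forall x y : E, inner x y = 0 ->
    f (a <*: x + (1 - a) <*: y) = a <*: f x + (1 - a) <*: f y.

Definition a_additive_on (E G : innerModType A) (K : set E) (T : E -> G) :
    Prop :=
  (forall x y, K x -> K y -> T (x + y) = T x + T y) /\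
  (forall x, K x -> T (a <*: x) = a <*: T x).

Definition a_biadditive_on (E G : innerModType A) (K : set E)
    (B : E -> E -> G) : Prop :=
  [/\ forall x y z, K x -> K y -> K z -> B (x + y) z = B x z + B y z,
      forall x y z, K x -> K y -> K z -> B x (y + z) = B x y + B x z,
      forall x, K x -> B (a <*: x) (a <*: x) = a <*: B x x
    & forall x, K x ->
        B ((1 - a) <*: x) ((1 - a) <*: x) = (1 - a) <*: B x x].

End Mappings.

Definition symmetric_on (E G : Type) (K : set E) (B : E -> E -> G) : Prop :=
  forall x y, K x -> K y -> B x y = B y x.

Definition orth_preserving_on (R : realType) (A : cstarAlgType R)
    (E G : innerModType A) (K : set E) (B : E -> E -> G) : Prop :=
  forall x y, K x -> K y -> inner x y = 0 -> B x y = 0.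

Definition jensen_decomposition (R : realType) (A : cstarAlgType R) (a : A)
    (E G : innerModType A) (K : set E) (f : E -> G)
    (T : E -> G) (B : E -> E -> G) : Prop :=
  [/\ a_additive_on a K T,
      symmetric_on K B,
      a_biadditive_on a K B,
      orth_preserving_on K B
    & forall x, K x -> f x = T x + B x x + f 0].

(* Main.v *)
(* Since [a] and [1 - a] are invertible, [g = f - f 0] commutes with both of
   them and is orthogonally additive.  Let [p, p'] and [q, q'] be mutually
   orthogonal pairs with the same inner products, so that [p + q] is orthogonal
   to [p' - q'].  Evaluating [g] at [(p + p') + (q - q') = (p + q) + (p' - q')]
   in both ways shows that the odd part of [g] is additive, and that its even
   part satisfies the parallelogram law, on such [p, p'].  This applies to
   [phi z, phi w] and to [psi z, psi w], after twisting the other family by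
   a suitable unit of the algebra; orthogonal additivity then carries both
   identities over to [K].  The even part is the diagonal of a biadditive map
   by the argument of Jordan and von Neumann. *)

Require Import Defs.
From mathcomp Require Import all_boot all_order all_algebra.
From mathcomp Require Import all_classical all_reals all_analysis.

Set Implicit Arguments.
Unset Strict Implicit.
Unset Printing Implicit Defensive.

Import Order.TTheory GRing.Theory Num.Theory.

Local Open Scope classical_set_scope.
Local Open Scope ring_scope.

(** * Inner product rules in the first variable *)

Section InnerProduct.
Context {R : realType} {A : cstarAlgType R} {E : innerModType A}.
Implicit Types (x y z : E) (b c : A).

Lemma star0 : star (0 : A) = 0.
Proof. by apply: (addrI (star 0)); rewrite -starD !addr0. Qed.

Lemma star1 : star (1 : A) = 1.
Proof. by rewrite -[LHS]mulr1 -{2}[1]starK -starM mulr1 starK. Qed.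

Lemma inner_starC x y : inner x y = star (inner y x).
Proof. by rewrite inner_star. Qed.

Lemma inner_orthC x y : inner x y = 0 -> inner y x = 0.
Proof. by move=> xy; rewrite inner_starC xy star0. Qed.

Lemma inner0r x : inner x 0 = 0.
Proof. by apply: (addrI (inner x 0)); rewrite -innerDr !addr0. Qed.

Lemma innerNr x y : inner x (- y) = - inner x y.
Proof. by apply: (addrI (inner x y)); rewrite -innerDr !subrr inner0r. Qed.

Lemma innerDl x y z : inner (x + y) z = inner x z + inner y z.
Proof. by rewrite inner_starC innerDr starD !inner_star. Qed.

Lemma innerNl x y : inner (- x) y = - inner x y.
Proof.
apply: (addrI (inner x y)); rewrite -innerDl !subrr.
exact/inner_orthC/inner0r.
Qed.

Lemma inner_actr x c y : inner x (c <*: y) = inner x y * c.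
Proof. exact: innerZr. Qed.

Lemma inner_actl c x y : inner (c <*: x) y = star c * inner x y.
Proof. by rewrite inner_starC inner_actr starM inner_star. Qed.

End InnerProduct.

(** * The module action and division by positive integers *)

Section Action.
Context {R : realType} {A : cstarAlgType R} {V : lmodType A^c}.
Implicit Types (x y : V) (b c : A) (k : R[i]) (n : nat).

Lemma act1 x : (1 : A) <*: x = x.
Proof. exact: scale1r. Qed.

Lemma actA b c x : b <*: (c <*: x) = (c * b) <*: x.
Proof. exact: scalerA. Qed.

Lemma actDr c x y : c <*: (x + y) = c <*: x + c <*: y.
Proof. exact: scalerDr. Qed.

Lemma actNr c x : c <*: (- x) = - (c <*: x).
Proof. exact: scalerN. Qed.

Lemma act0r c : c <*: (0 : V) = 0.
Proof. exact: scaler0. Qed.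

Lemma actDl b c x : (b + c) <*: x = b <*: x + c <*: x.
Proof. exact: scalerDl. Qed.

Lemma act1B c x : (1 - c) <*: x = x - c <*: x.
Proof. by rewrite actDl act1 [in LHS]/mod_act scaleNr. Qed.

Lemma complex_scaleA k l x :
  complex_scale k (complex_scale l x) = complex_scale (k * l) x.
Proof. by rewrite /complex_scale actA mulr_algl scalerA mulrC. Qed.

Lemma complex_scale_act k c x :
  complex_scale k (c <*: x) = c <*: complex_scale k x.
Proof. by rewrite /complex_scale !actA mulr_algl mulr_algr. Qed.

Lemma complex_scale_nat n x : complex_scale n%:R x = x *+ n.
Proof.
rewrite /complex_scale scaler_nat.
elim: n => [|n IHn]; first by rewrite !mulr0n; exact: scale0r.
by rewrite !mulrS actDl act1 IHn.
Qed.

Lemma complex_scaleKn n x : complex_scale n.+1%:R^-1 (x *+ n.+1) = x.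
Proof.
rewrite -complex_scale_nat complex_scaleA mulVf ?pnatr_eq0//.
by rewrite (complex_scale_nat 1).
Qed.

Lemma complex_scaleVKn n x : complex_scale n.+1%:R^-1 x *+ n.+1 = x.
Proof.
rewrite -complex_scale_nat complex_scaleA mulfV ?pnatr_eq0//.
by rewrite (complex_scale_nat 1).
Qed.

(** Modules over a complex algebra have no integer torsion. Identities with denominators are proved
    below after clearing them by this cancellation. *)
Lemma mulrSn_inj n x y : x *+ n.+1 = y *+ n.+1 -> x = y.
Proof.
by move=> /(congr1 (complex_scale n.+1%:R^-1)); rewrite !complex_scaleKn.
Qed.

End Action.

(** * Orthogonally additive maps on isometric orthogonal families *)

Section OrthogonallyAdditive.
Context {R : realType} {A : cstarAlgType R} {E G : innerModType A}.

Definition orth_additive (g : E -> G) : Prop :=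
  forall x y, inner x y = 0 -> g (x + y) = g x + g y.

(** Mutually orthogonal families with the same Gram matrix. The index type is arbitrary so that
    additive maps on [F] count as families. *)
Definition orth_isometric {I : Type} (p q : I -> E) : Prop :=
  (forall i j, inner (p i) (q j) = 0) /\
  (forall i j, inner (p i) (p j) = inner (q i) (q j)).

Lemma orth_isometricC I (p q : I -> E) :
  orth_isometric p q -> orth_isometric q p.
Proof.
by move=> [pq ppqq]; split=> i j; [exact/inner_orthC/pq|rewrite ppqq].
Qed.

Lemma orth_isometric_act I (c : A) (p q : I -> E) :
  orth_isometric p q ->
  orth_isometric (fun i => c <*: p i) (fun i => c <*: q i).
Proof.
move=> [pq ppqq]; split=> i j; rewrite !inner_actr !inner_actl ?pq ?ppqq//.
by rewrite mulr0 mul0r.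
Qed.

(* [p i + p j] and [q i - q j] are orthogonal, as are [p i + q i] and
   [p j - q j]; the two orthogonal sums agree. *)
Lemma orth_additive_rotate I (p q : I -> E) (g : E -> G) i j :
    orth_isometric p q -> orth_additive g ->
  g (p i + p j) + g (q i - q j) = g (p i) + g (q i) + g (p j) + g (- q j).
Proof.
move=> pqP gD; have [pq ppqq] := pqP; have [qp _] := orth_isometricC pqP.
rewrite -gD; last by rewrite innerDl !innerDr !innerNr !pq subrr addr0.
rewrite addrACA gD ?gD ?addrA// ?innerNr ?pq ?oppr0//.
by rewrite innerDl !innerDr !innerNr pq qp ppqq oppr0 addr0 add0r subrr.
Qed.

(** Add the rotation identities for [(i, j)] and [(j, i)]: for odd [g] all values on the [q] side
    cancel, leaving twice the claim. *)
Lemma orth_additive_odd I (p q : I -> E) (g : E -> G) i j :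
    orth_isometric p q -> orth_additive g -> (forall x, g (- x) = - g x) ->
  g (p i + p j) = g (p i) + g (p j).
Proof.
move=> pqP gD gN; apply: (@mulrSn_inj _ _ _ 1).
have := congr2 +%R (orth_additive_rotate i j pqP gD)
                   (orth_additive_rotate j i pqP gD).
rewrite addrACA -[q j - q i]opprB !gN subrr addr0 [p j + p i]addrC.
rewrite -mulr2n => ->.
rewrite !addrA (ACl ((1*3)*(7*5)*(2*8)*(6*4)))%AC/= !subrr !addr0.
by rewrite mulr2n.
Qed.

(** Rotating the halves of [p i] and [q i] with equal indices expresses [g (p i)] by a sum which,
    for even [g], is symmetric in [p] and [q]. *)
Lemma orth_additive_even_eq I (p q : I -> E) (g : E -> G) i :
    orth_isometric p q -> orth_additive g -> (forall x, g (- x) = g x) ->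
  g (p i) = g (q i).
Proof.
move=> pqP gD gN.
pose p' i := complex_scale 2%:R^-1 (p i).
pose q' i := complex_scale 2%:R^-1 (q i).
have p'q'P : orth_isometric p' q' by exact: orth_isometric_act.
have g0 : g 0 = 0.
  by apply: (addrI (g 0)); rewrite -gD ?addr0//; exact: inner0r.
have := orth_additive_rotate i i p'q'P gD.
have := orth_additive_rotate i i (orth_isometricC p'q'P) gD.
rewrite !gN !subrr !g0 !addr0 -!mulr2n !complex_scaleVKn => -> ->.
by rewrite (ACl (2*1*4*3))%AC.
Qed.

(** The index [k] makes the two differences matching members of the families, so [g] agrees on them
    and the rotation identity becomes the parallelogram law. *)
Lemma orth_additive_even I (p q : I -> E) (g : E -> G) i j :
    orth_isometric p q -> orth_additive g -> (forall x, g (- x) = g x) ->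
    (exists k, p k = p i - p j /\ q k = q i - q j) ->
  g (p i + p j) + g (p i - p j) = g (p i) *+ 2 + g (p j) *+ 2.
Proof.
move=> pqP gD gN [k [pk qk]].
rewrite -pk (orth_additive_even_eq _ pqP)// qk.
rewrite (orth_additive_rotate i j pqP)// gN -!(orth_additive_even_eq _ pqP)//.
by rewrite !mulr2n addrA.
Qed.

End OrthogonallyAdditive.

(** * From the parallelogram law to biadditivity (Jordan and von Neumann) *)

Section Quadratic.
Context {R : realType} {A : cstarAlgType R} {E G : innerModType A}.
Context {K : set E} {h : E -> G}.
Hypotheses (K0 : K 0) (KD : forall x y, K x -> K y -> K (x + y)).
Hypothesis KN : forall x, K x -> K (- x).
Hypothesis hN : forall x, h (- x) = h x.
Hypothesis h_quad : forall x y, K x -> K y ->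
  h (x + y) + h (x - y) = h x *+ 2 + h y *+ 2.

Let S x y := h (x + y) - h (x - y).

(** The parallelogram law for the pairs [x + z], [y + z] and [x - z], [y - z] has the same
    difference term [h (x - y)], which cancels on subtraction. *)
Let S_double x y z : K x -> K y -> K z ->
  (S x z + S y z) *+ 2 = S (x + y) (z + z).
Proof.
move=> Kx Ky Kz; rewrite /S addrACA -opprD mulrnBl !mulrnDl.
rewrite -!h_quad; do ?[by apply: KD => //; exact: KN].
have subD (V : zmodType) (u v w : V) : u + w - (v + w) = u - v.
  by rewrite opprD addrACA subrr addr0.
by rewrite !(subD E) [x + z + _]addrACA [x - z + _]addrACA -opprD (subD G).
Qed.

Lemma quadratic_polarDl x y z : K x -> K y -> K z ->
  h (x + y + z) - h (x + y - z) =
  (h (x + z) - h (x - z)) + (h (y + z) - h (y - z)).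
Proof.
move=> Kx Ky Kz; apply: (@mulrSn_inj _ _ _ 1).
have S0 : S 0 z = 0 by rewrite /S add0r sub0r hN subrr.
(* Doubling in the second variable is [S_double] for the pair [x + y], [0]. *)
have SD : S (x + y) z *+ 2 = S (x + y) (z + z).
  by rewrite -[X in X *+ 2]addr0 -S0 S_double ?addr0//; exact: KD.
by rewrite -!/(S _ _) SD -S_double.
Qed.

End Quadratic.

(** * From Jensen mappings to orthogonally additive ones *)

Section Jensen.
Context {R : realType} {A : cstarAlgType R} {E G : innerModType A}.
Context {a : A} {f : E -> G}.
Hypotheses (a_inv : a \is a GRing.unit) (a1_inv : 1 - a \is a GRing.unit).
Hypothesis f_jensen : orth_jensen a f.

Let g x := f x - f 0.

Lemma jensen_actl x : g (a <*: x) = a <*: g x.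
Proof.
have := f_jensen (inner0r x); rewrite act0r addr0 /g => ->.
by rewrite act1B -addrA [_ - f 0]addrAC subrr add0r actDr actNr.
Qed.

Lemma jensen_actr x : g ((1 - a) <*: x) = (1 - a) <*: g x.
Proof.
have := f_jensen (inner_orthC (inner0r x)); rewrite act0r add0r /g => ->.
by rewrite actDr actNr [in RHS](act1B _ (f 0)) opprB addrAC addrC.
Qed.

(** Invertibility writes [x] and [y] as multiples by [a] and [1 - a] of vectors that are still
    orthogonal; the constants recombine since [a + (1 - a) = 1]. *)
Lemma jensen_orth_additive : orth_additive g.
Proof.
move=> x y xy.
have xE : x = a <*: (a^-1 <*: x) by rewrite actA mulVr// act1.
have yE : y = (1 - a) <*: ((1 - a)^-1 <*: y) by rewrite actA mulVr// act1.
rewrite {2}xE {2}yE jensen_actl jensen_actr /g {1}xE {1}yE f_jensen; last first.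
  by rewrite inner_actr inner_actl xy mulr0 mul0r.
rewrite !actDr !actNr addrACA -opprD -actDl [a + _]addrC subrK.
by rewrite act1.
Qed.

End Jensen.

(** * Closure properties used for odd and even parts *)

Section Parity.
Context {R : realType} {A : cstarAlgType R} {E G : innerModType A}.
Context {g : E -> G}.

Lemma orth_additive_opp : orth_additive g -> orth_additive (fun x => g (- x)).
Proof. by move=> gD x y xy; rewrite opprD gD// innerNl innerNr xy !oppr0. Qed.

Lemma orth_additiveD (g' : E -> G) :
  orth_additive g -> orth_additive g' -> orth_additive (fun x => g x + g' x).
Proof. by move=> gD gD' x y xy; rewrite gD// gD'// addrACA. Qed.

Lemma orth_additiveB (g' : E -> G) :
  orth_additive g -> orth_additive g' -> orth_additive (fun x => g x - g' x).
Proof. by move=> gD gD' x y xy; rewrite gD// gD'// opprD addrACA. Qed.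

End Parity.

(** * Additivity and parallelogram law on a single range *)

Section Range.
Context {R : realType} {A : cstarAlgType R} {b c : A}.
Context {E F G : innerModType A} {phi psi : {additive F -> E}}.
Hypothesis b_inv : b \is a GRing.unit.
Hypothesis phi_psi_orth : forall z w, inner (phi z) (psi w) = 0.
Hypothesis phi_psi_eq : forall z w,
  b * inner (phi z) (phi w) * star b = c * inner (psi z) (psi w) * star c.

(* The hypothesis makes [b^* phi] and [c^* psi] isometric, but a Jensen map
   need not be homogeneous for [b^*] and [c^*].  Moving the whole twist onto one
   family keeps the values of the other one. *)
Lemma orth_isometric_range :
  orth_isometric phi (fun z => star (b^-1 * c) <*: psi z).
Proof.
split=> z w; first by rewrite inner_actr phi_psi_orth mul0r.
have -> : inner (phi z) (phi w) =
    b^-1 * (b * inner (phi z) (phi w) * star b) * star b^-1.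
  by rewrite !mulrA mulVr// mul1r -mulrA -starM mulVr// star1 mulr1.
by rewrite phi_psi_eq inner_actr inner_actl starK starM !mulrA.
Qed.

Lemma orth_additive_odd_range (g : E -> G) z w :
    orth_additive g -> (forall x, g (- x) = - g x) ->
  g (phi z + phi w) = g (phi z) + g (phi w).
Proof. exact/orth_additive_odd/orth_isometric_range. Qed.

Lemma orth_additive_even_range (g : E -> G) z w :
    orth_additive g -> (forall x, g (- x) = g x) ->
  g (phi z + phi w) + g (phi z - phi w) = g (phi z) *+ 2 + g (phi w) *+ 2.
Proof.
move=> gD gN; apply: (orth_additive_even orth_isometric_range) => //.
(* By additivity the index [z - w] realizes the difference in both families. *)
by exists (z - w); rewrite !raddfB /= actDr actNr.
Qed.

End Range.

(** * Passage to the sum of the two ranges *)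

Section SumOfRanges.
Context {R : realType} {A : cstarAlgType R} {b c : A}.
Context {E F G : innerModType A} {phi psi : {additive F -> E}}.
Hypotheses (b_inv : b \is a GRing.unit) (c_inv : c \is a GRing.unit).
Hypothesis phi_psi_orth : forall z w, inner (phi z) (psi w) = 0.
Hypothesis phi_psi_eq : forall z w,
  b * inner (phi z) (phi w) * star b = c * inner (psi z) (psi w) * star c.

Let K := [set phi z + psi w | z in [set: F] & w in [set: F]].

Lemma sum_ranges0 : K 0.
Proof. by exists 0 => //; exists 0 => //; rewrite !raddf0 addr0. Qed.

Lemma sum_rangesD x y : K x -> K y -> K (x + y).
Proof.
move=> [z _ [w _ <-]] [z' _ [w' _ <-]].
by exists (z + z') => //; exists (w + w') => //; rewrite !raddfD addrACA.
Qed.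

Lemma sum_rangesN x : K x -> K (- x).
Proof.
move=> [z _ [w _ <-]].
by exists (- z) => //; exists (- w) => //; rewrite !raddfN opprD.
Qed.

(** The hypotheses are invariant under exchanging [phi, b] with [psi, c], so the results on the
    range of [phi] also hold on that of [psi]. *)
Let psi_phi_orth z w : inner (psi z) (phi w) = 0.
Proof. exact: inner_orthC. Qed.

Let psi_phi_eq z w :
  c * inner (psi z) (psi w) * star c = b * inner (phi z) (phi w) * star b.
Proof. by rewrite phi_psi_eq. Qed.

(** The [phi] and [psi] components of any element of [K] are orthogonal, so [g] splits over them and
    each range is treated separately. *)
Lemma sum_ranges_odd (g : E -> G) x y :
    orth_additive g -> (forall u, g (- u) = - g u) -> K x -> K y ->
  g (x + y) = g x + g y.
Proof.
move=> gD gN [z _ [w _ <-]] [z' _ [w' _ <-]].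
rewrite addrACA -!raddfD !gD// !raddfD.
rewrite (orth_additive_odd_range b_inv phi_psi_orth phi_psi_eq)//.
by rewrite (orth_additive_odd_range c_inv psi_phi_orth psi_phi_eq)// addrACA.
Qed.

Lemma sum_ranges_even (g : E -> G) x y :
    orth_additive g -> (forall u, g (- u) = g u) -> K x -> K y ->
  g (x + y) + g (x - y) = g x *+ 2 + g y *+ 2.
Proof.
move=> gD gN [z _ [w _ <-]] [z' _ [w' _ <-]].
rewrite opprD addrACA [X in _ + g X]addrACA -!raddfD -!raddfB !gD//.
rewrite addrACA !raddfD !raddfN.
rewrite (orth_additive_even_range b_inv phi_psi_orth phi_psi_eq)//.
rewrite (orth_additive_even_range c_inv psi_phi_orth psi_phi_eq)//.
by rewrite addrACA !mulrnDl.
Qed.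

End SumOfRanges.

(** * Recovering the two mappings from the values of [f] *)

Section Uniqueness.
Context {R : realType} {A : cstarAlgType R} {a : A}.
Context {E G : innerModType A} {K : set E} {f : E -> G}.
Hypotheses (K0 : K 0) (KD : forall x y, K x -> K y -> K (x + y)).
Hypothesis KN : forall x, K x -> K (- x).
Context {T : E -> G} {B : E -> E -> G}.
Hypothesis TB : jensen_decomposition a K f T B.

Let TN x : K x -> T (- x) = - T x.
Proof.
have [[TD _] _ _ _ _] := TB; move=> Kx; apply: (addrI (T x)).
rewrite -TD ?subrr//; last exact: KN.
by apply: (addrI (T 0)); rewrite -TD// !addr0.
Qed.

Let BNl x y : K x -> K y -> B (- x) y = - B x y.
Proof.
have [_ _ [BD _ _ _] _ _] := TB; move=> Kx Ky; apply: (addrI (B x y)).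
rewrite -BD ?subrr//; last exact: KN.
by apply: (addrI (B 0 y)); rewrite -BD// !addr0.
Qed.

Let BNN x : K x -> B (- x) (- x) = B x x.
Proof.
have [_ Bsym _ _ _] := TB => Kx; have KNx := KN Kx.
by rewrite BNl// Bsym// BNl// opprK.
Qed.

(** Compare the decomposition at [x] and [- x]: [T] is odd on [K], while the diagonal of [B] and the
    constant are even. *)
Lemma jensen_decomposition_odd x : K x -> T x *+ 2 = f x - f (- x).
Proof.
have [_ _ _ _ fE] := TB => Kx; have KNx := KN Kx.
rewrite (fE x)// (fE (- x))// TN// BNN// -!addrA opprD opprK.
by rewrite [B x x + (f 0 + _)]addrA addrA addrACA subrr addr0 mulr2n.
Qed.

Lemma jensen_decomposition_even x : K x ->
  B x x *+ 2 = f x + f (- x) - f 0 *+ 2.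
Proof.
have [_ _ _ _ fE] := TB => Kx; have KNx := KN Kx.
rewrite (fE x)// (fE (- x))// TN// BNN// addrACA -mulr2n addrK.
by rewrite addrACA subrr add0r mulr2n.
Qed.

Lemma jensen_decomposition_polar x y : K x -> K y ->
  B x y *+ 4 = B (x + y) (x + y) - B (x - y) (x - y).
Proof.
have [_ Bsym [BDl BDr _ _] _ _] := TB => Kx Ky; have KNy := KN Ky.
have BxN : B x (- y) = - B x y by rewrite Bsym// BNl// Bsym.
rewrite (BDl x y)//; last exact: KD.
rewrite (BDl x (- y))//; last exact: KD.
rewrite (BDr x x y)// (BDr y x y)// (BDr x x (- y))// (BDr (- y) x (- y))//.
rewrite BNN// BxN BNl// (Bsym y x)//.
rewrite !opprD !opprK !addrA (ACl ((1*5)*(4*8)*(2*3*6*7)))%AC/=.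
by rewrite !subrr !add0r !mulrS addr0 !addrA.
Qed.

End Uniqueness.

(** * Existence, uniqueness and explicit formulas *)

Theorem theorem2p6 (R : realType) (A : cstarAlgType R) (a : A)
  (a_inv : a \is a GRing.unit) (a1_inv : 1 - a \is a GRing.unit)
  (E F G : innerModType A) (phi psi : {additive F -> E})
  (phi_psi_orth : forall z w : F, inner (phi z) (psi w) = 0)
  (phi_psi_eq : forall z w : F,
     a * inner (phi z) (phi w) * star a =
     (1 - a) * inner (psi z) (psi w) * star (1 - a))
  (f : E -> G) (f_jensen : orth_jensen a f) :
  let K := [set phi z + psi w | z in [set: F] & w in [set: F]] in
  exists (T : E -> G) (B : E -> E -> G),
    [/\ jensen_decomposition a K f T B,
        forall (T' : E -> G) (B' : E -> E -> G),
          jensen_decomposition a K f T' B' ->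
          (forall x, K x -> T' x = T x) /\
          (forall x y, K x -> K y -> B' x y = B x y),
        forall x y : E,
          B x y = complex_scale 8%:R^-1
                    (f (x + y) + f (- x - y) - f (x - y) - f (- x + y))
      & forall x : E, T x = complex_scale 2%:R^-1 (f x - f (- x))].
Proof.

move=> K.
have [g [gE [gD ga ga1]]] : exists g : E -> G, (forall x, g x = f x - f 0) /\
    [/\ orth_additive g, forall x, g (a <*: x) = a <*: g x
      & forall x, g ((1 - a) <*: x) = (1 - a) <*: g x].
  exists (fun x => f x - f 0); split=> //; split.
  - exact: jensen_orth_additive a_inv a1_inv f_jensen.
  - exact: jensen_actl f_jensen.
  - exact: jensen_actr f_jensen.
(* Twice the odd and even parts of [g], left unhalved to keep integer coefficients. *)
pose o x := g x - g (- x); pose h x := g x + g (- x).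
have oD : orth_additive o := orth_additiveB gD (orth_additive_opp gD).
have hD : orth_additive h := orth_additiveD gD (orth_additive_opp gD).
have oN x : o (- x) = - o x by rewrite /o opprK opprB.
have hN x : h (- x) = h x by rewrite /h opprK addrC.
have h0 : h 0 = 0 by rewrite /h oppr0 !gE subrr addr0.
have oE x : o x = f x - f (- x) by rewrite /o !gE opprB addrA subrK.
have hE x : h x = f x + f (- x) - f 0 *+ 2.
  by rewrite /h !gE addrACA -opprD mulr2n.
have K0 : K 0 := sum_ranges0.
have KD : forall x y, K x -> K y -> K (x + y) := @sum_rangesD _ _ _ _ phi psi.
have KN : forall x, K x -> K (- x) := @sum_rangesN _ _ _ _ phi psi.
have oDK x y : K x -> K y -> o (x + y) = o x + o y.
  exact: (sum_ranges_odd a_inv a1_inv phi_psi_orth phi_psi_eq).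
have h_quad x y : K x -> K y -> h (x + y) + h (x - y) = h x *+ 2 + h y *+ 2.
  exact: (sum_ranges_even a_inv a1_inv phi_psi_orth phi_psi_eq).
pose T x := complex_scale 2%:R^-1 (f x - f (- x)).
(* The factor 8 combines 4 from polarization and 2 from [h] being twice the even part. *)
pose B x y := complex_scale 8%:R^-1
  (f (x + y) + f (- x - y) - f (x - y) - f (- x + y)).
have T2 x : T x *+ 2 = o x by rewrite complex_scaleVKn oE.
have BE x y : B x y = complex_scale 8%:R^-1 (h (x + y) - h (x - y)).
  rewrite !hE opprB addrA subrK /B !opprD !opprK.
  by rewrite addrA.
have B8 x y : B x y *+ 8 = h (x + y) - h (x - y).
  by rewrite BE complex_scaleVKn.
(* The parallelogram law at [x = y] gives [h (x + x) = h x *+ 4]. *)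
have Bxx x : K x -> B x x *+ 2 = h x.
  move=> Kx; apply: (@mulrSn_inj _ _ _ 3); rewrite -mulrnA B8 subrr h0 subr0.
  by have := h_quad x x Kx Kx; rewrite subrr h0 addr0 -mulrnDl -mulr2n -mulrnA.
have Bsym x y : B x y = B y x.
  by rewrite !BE [y + x]addrC -[h (x - y)]hN opprB.
have BDl x y z : K x -> K y -> K z -> B (x + y) z = B x z + B y z.
  move=> Kx Ky Kz; apply: (@mulrSn_inj _ _ _ 7).
  by rewrite mulrnDl !B8 (quadratic_polarDl K0 KD KN hN h_quad).
have Bact c x : (forall u, g (c <*: u) = c <*: g u) ->
    B (c <*: x) (c <*: x) = c <*: B x x.
  move=> gc; rewrite !BE !subrr h0 !subr0 -complex_scale_act -actDr.
  by rewrite /h -actNr !gc actDr.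
exists T, B; split=> //; [split|].
- split=> [x y Kx Ky|x _].
    by apply: (@mulrSn_inj _ _ _ 1); rewrite mulrnDl !T2 oDK.
  rewrite /T -!oE -complex_scale_act /o -actNr !ga.
  by rewrite actDr actNr.
- by move=> x y _ _; exact: Bsym.
- split=> [//|x y z Kx Ky Kz|x _|x _].
  + by rewrite Bsym BDl// ![B _ x]Bsym.
  + exact: Bact.
  + exact: Bact.
- move=> x y _ _ xy; apply: (@mulrSn_inj _ _ _ 7).
  (* For orthogonal [x], [y], both [h (x + y)] and [h (x - y)] equal [h x + h y]. *)
  by rewrite mul0rn B8 !hD ?hN ?subrr// innerNr xy oppr0.
- move=> x Kx; apply/eqP; rewrite -subr_eq; apply/eqP.
  (* After doubling, this is [o x + h x = g x *+ 2]. *)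
  apply: (@mulrSn_inj _ _ _ 1); rewrite -gE [RHS]mulrnDl T2 Bxx// /o /h addrACA.
  by rewrite [- _ + _]addrC subrr addr0 mulr2n.
- move=> T' B' TB'; split=> [x Kx|x y Kx Ky].
    apply: (@mulrSn_inj _ _ _ 1).
    by rewrite T2 oE (jensen_decomposition_odd K0 KN TB').
  (* Polarization reduces [B' x y *+ 4] to diagonal values, and doubling these expresses them
     through [f]. *)
  apply: (@mulrSn_inj _ _ _ 7); rewrite B8 (mulrnA _ 4 2).
  rewrite (jensen_decomposition_polar K0 KD KN TB')// mulrnBl !hE.
  have Kxy := KD _ _ Kx Ky; have KxNy := KD _ _ Kx (KN _ Ky).
  by rewrite !(jensen_decomposition_even K0 KN TB').
Qed.
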